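(* Three-dimensional canonical fusion bialgebras whose basis $\{x_1=1,x_2,x_3\}$ satisfies $x_2^*=x_3$ are classified by one parameter $\mu\ge3$ (the Frobenius-Perron dimension). Moreover, with $d_2=d(x_2)$ and $d_3=d(x_3)$, one has $d_2=d_3=\sqrt{\frac{\mu-1}{2}}$ and $$x_2x_2=\frac{d_2^2-1}{2d_2}x_2+\frac{d_2^2+1}{2d_2}x_3,\qquad x_2x_3=x_1+\frac{d_2^2-1}{2d_2}(x_2+x_3),\qquad x_3x_3=\frac{d_2^2+1}{2d_2}x_2+\frac{d_2^2-1}{2d_2}x_3.$$ That is: every such canonical fusion bialgebra has $\mu\ge3$ and satisfies these formulas, and conversely for every real $\mu\ge3$ these formulas (with $x_1=1$, $x_2^*=x_3$, $d_2=\sqrt{(\mu-1)/2}$) define a three-dimensional algebra with $\mathbb{R}_{\ge0}$-basis $\{x_1,x_2,x_3\}$, hence a canonical fusion bialgebra of this kind with Frobenius-Perron dimension $\mu$.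
   Context: $\mathbb{R}_{\ge0}$-basis: a unital $*$-algebra $\mathcal{B}$ over $\mathbb{C}$ has an $\mathbb{R}_{\ge 0}$-basis $B=\{x_1=1_{\mathcal{B}},x_2,\dots,x_m\}$ if (1) it is a linear basis over $\mathbb{C}$; (2) $x_jx_k=\sum_s N_{j,k}^s x_s$ with $N_{j,k}^s\in\mathbb{R}_{\ge0}$; (3) there is an involution $*$ on $\{1,\dots,m\}$ such that $x_k^*=x_{k^*}$ and $N_{j,k}^1=\delta_{j,k^*}$. Put $\tau(x_j)=\delta_{j,1}$; this is a faithful tracial state, for which $B$ is orthonormal in $L^2(\mathcal{B},\tau)$, and $\mathcal{B}$ becomes a $C^*$-algebra via left multiplication on $L^2(\mathcal{B},\tau)$; $d:\mathcal{B}\to\mathbb{C}$ is the linear functional with $d(x_j)$ equal to the operator norm of left multiplication by $x_j$. The canonical fusion bialgebra of $(\mathcal{B},B)$ is $(\mathcal{A},\mathcal{B},\mathfrak{F},d,\tau)$, where $\mathcal{A}$ is the commutative $C^*$-algebra with linear basis $B$, multiplication $x_j\diamond x_k=\delta_{j,k}d(x_j)^{-1}x_j$ and anti-linear involution $x_j^{\#}=x_j$, $d$ is regarded as a functional on $\mathcal{A}$, and $\mathfrak{F}(x_j)=x_j$. Every canonical fusion bialgebra arises in this way from a unique $\mathbb{R}_{\ge0}$-basis (its basis); its dimension is $\dim_{\mathbb{C}}\mathcal{B}$, and its Frobenius-Perron dimension is $\mu=\sum_{j=1}^m d(x_j)^2$. *)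

(* Defs.v *)
From HB Require Import structures.
From mathcomp Require Import all_boot all_order all_algebra all_field.
From mathcomp Require Import all_classical all_reals.
From mathcomp Require Export complex.
Set Implicit Arguments.
Unset Strict Implicit.
Unset Printing Implicit Defensive.
Import Order.TTheory GRing.Theory Num.Theory.
Local Open Scope ring_scope.
Local Open Scope complex_scope.

Record star_axioms (R : realType) (A : algType R[i]) (star : A -> A) : Prop := {
  star_antilinear : forall (a : R[i]) (u v : A),
    star (a *: u + v) = conjc a *: star u + star v;
  star_involutive : involutive star;
  star_antimul : forall u v : A, star (u * v) = star v * star u
}.

(* An R_{>=0}-basis x_1 = 1, ..., x_m with m = n.+1; the index 1 of x_1 is
   ord0 here.  In R[i], 0 <= z means that z is real and nonnegative. *)
Section RnnBasis.
Variables (R : realType) (B : falgType R[i]) (star : B -> B).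
Variables (n : nat) (x : n.+1.-tuple B).

Definition fusion_coef (j k s : 'I_n.+1) : R[i] :=
  coord x s (tnth x j * tnth x k).

Record rnn_basis : Prop := {
  rnn_basis_linear : basis_of fullv x;
  rnn_basis_one : tnth x ord0 = 1;
  rnn_basis_ge0 : forall j k s, 0 <= fusion_coef j k s;
  rnn_basis_dual : exists dual : 'I_n.+1 -> 'I_n.+1,
    [/\ involutive dual,
        forall k, star (tnth x k) = tnth x (dual k) &
        forall j k, fusion_coef j k ord0 = (j == dual k)%:R]
}.

End RnnBasis.

(* The quintuple (A, B, F, d, tau) together with the involutions of A and B.
   Only the data are recorded here; [canonical_fusion_bialgebra] states the
   axioms. *)
Record fusion_bialgebra (R : realType) := FusionBialgebra {
  fb_A : falgType R[i];
  fb_B : falgType R[i];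
  fb_sharp : fb_A -> fb_A;
  fb_star : fb_B -> fb_B;
  fb_F : {linear fb_A -> fb_B};
  fb_d : {scalar fb_A};
  fb_tau : {scalar fb_B}
}.

Section FusionBialgebra.
Variables (R : realType) (X : fusion_bialgebra R).

Definition L2norm (b : fb_B X) : R :=
  Num.sqrt (complex.Re (fb_tau X (fb_star b * b))).

(* Operator norm of the left multiplication by b on L^2(B, tau). *)
Definition lmul_norm (b : fb_B X) : R :=
  sup [set L2norm (b * a) | a in [set a : fb_B X | L2norm a <= 1]]%classic.

(* X is the canonical fusion bialgebra of (fb_B X, x).  The tuple y is the
   basis x seen in A.  No norm is recorded: a finite-dimensional *-algebra
   has at most one C^*-norm, and the equations below make both A and B
   C^*-algebras. *)
Definition canonical_fusion_bialgebra (n : nat) (x : n.+1.-tuple (fb_B X)) : Prop :=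
  [/\ star_axioms (@fb_star R X), rnn_basis (@fb_star R X) x,
      forall j, fb_tau X (tnth x j) = (j == ord0)%:R,
      star_axioms (@fb_sharp R X) &
      exists y : n.+1.-tuple (fb_A X),
      [/\ basis_of fullv y,
          forall j, fb_F X (tnth y j) = tnth x j,
          forall j, fb_d X (tnth y j) = (lmul_norm (tnth x j))%:C,
          forall j k, tnth y j * tnth y k =
            if j == k then (fb_d X (tnth y j))^-1 *: tnth y j else 0 &
          forall j, fb_sharp (tnth y j) = tnth y j]].

(* On the basis of a canonical fusion bialgebra, d(x_j) = lmul_norm x_j. *)
Definition FPdim (n : nat) (x : n.+1.-tuple (fb_B X)) : R :=
  \sum_(j < n.+1) lmul_norm (tnth x j) ^+ 2.

Definition fusion_rules (x1 x2 x3 : fb_B X) (d2 : R) : Prop :=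
  let a := ((d2 ^+ 2 - 1) / (2 * d2))%:C in
  let b := ((d2 ^+ 2 + 1) / (2 * d2))%:C in
  [/\ x2 * x2 = a *: x2 + b *: x3,
      x2 * x3 = x1 + a *: (x2 + x3) &
      x3 * x3 = b *: x2 + a *: x3].

End FusionBialgebra.

Definition fb_isomorphic (R : realType) (X Y : fusion_bialgebra R) : Prop :=
  exists (f : {lrmorphism fb_A X -> fb_A Y})
         (g : {lrmorphism fb_B X -> fb_B Y}),
  [/\ bijective f /\ bijective g,
      forall a, f (fb_sharp a) = fb_sharp (f a),
      forall b, g (fb_star b) = fb_star (g b),
      forall a, g (fb_F X a) = fb_F Y (f a) &
      (forall a, fb_d Y (f a) = fb_d X a) /\
      (forall b, fb_tau Y (g b) = fb_tau X b)].

(* Main.v *)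
(* With x_2^* = x_3, conjugation and the trace condition leave
   x_2 x_2 = a x_2 + b x_3, x_2 x_3 = 1 + c (x_2 + x_3) and
   x_3 x_2 = 1 + e (x_2 + x_3); associativity forces a = c = e and
   b^2 = 1 + a^2, so that d = a + b >= 1 determines a and b.  The vector
   1 + d x_2 + d x_3 is an eigenvector, for the eigenvalue d, of the left
   multiplications by x_2 and x_3, and d bounds their norm because
   d^2 |v|^2 - |x_2 v|^2 is a nonnegative combination of squares; hence
   d(x_2) = d(x_3) = d and mu = 1 + 2 d^2.
   Conversely, for d >= 1 both A and B are C^3 with pointwise operations: x_2 is
   (d, z, w), where z and its conjugate w have sum -1/d and product
   (1 + d^-2) / 2, and y_j is the j-th unit vector divided by d(x_j). *)
From HB Require Import structures.
Require Import Defs.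
From mathcomp Require Import all_boot all_order all_algebra all_field.
From mathcomp Require Import all_classical all_reals.
From mathcomp Require Import ring lra.
Set Implicit Arguments.
Unset Strict Implicit.
Unset Printing Implicit Defensive.
Import Order.TTheory GRing.Theory Num.Theory.
Local Open Scope ring_scope.
Local Open Scope complex_scope.

(** * Coordinates with respect to a basis *)

Lemma complex_ge0P (R : realType) (z : R[i]) :
  0 <= z -> exists2 r : R, 0 <= r & z = r%:C.
Proof.
case: z => a b; rewrite lecE /= => /andP[/eqP -> a0].
by exists a.
Qed.

Lemma coord_tnth_basis (K : fieldType) (V : vectType K) n (e : n.-tuple V) v :
  basis_of fullv e -> v = \sum_i coord e i v *: tnth e i.
Proof.
move=> be; rewrite {1}(coord_basis be (memvf v)).
by apply: eq_bigr => i _; rewrite (tnth_nth 0).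
Qed.

Lemma coord_inj_basis (K : fieldType) (V : vectType K) n (e : n.-tuple V) u v :
  basis_of fullv e -> (forall i, coord e i u = coord e i v) -> u = v.
Proof.
move=> be uv; rewrite (coord_tnth_basis u be) (coord_tnth_basis v be).
by apply: eq_bigr => i _; rewrite uv.
Qed.

Lemma coord_tnth (K : fieldType) (V : vectType K) n (e : n.-tuple V) i j :
  basis_of fullv e -> coord e i (tnth e j) = (i == j)%:R.
Proof.
by move=> /basis_free fe; rewrite (tnth_nth 0) coord_free // eq_sym.
Qed.

Lemma coord_sum_tnth (K : fieldType) (V : vectType K) n (e : n.-tuple V)
    (c : 'I_n -> K) i :
  basis_of fullv e -> coord e i (\sum_j c j *: tnth e j) = c i.
Proof.
move=> /basis_free fe; rewrite -[RHS](coord_sum_free c i fe).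
by congr (coord e i _); apply: eq_bigr => j _; rewrite (tnth_nth 0).
Qed.

(** * Antilinear involutions *)

Section StarAxioms.
Variables (R : realType) (A : algType R[i]) (star : A -> A).
Hypothesis sA : star_axioms star.

Lemma star0 : star 0 = 0.
Proof.
have := star_antilinear sA 1 0 0.
rewrite scaler0 addr0 conjc1 scale1r => /esym /eqP.
by rewrite -subr_eq0 addrK => /eqP.
Qed.

Lemma starZ a u : star (a *: u) = conjc a *: star u.
Proof. by have := star_antilinear sA a u 0; rewrite star0 !addr0. Qed.

Lemma starD u v : star (u + v) = star u + star v.
Proof.
by have := star_antilinear sA 1 u v; rewrite conjc1 !scale1r.
Qed.

Lemma star_sum n (c : 'I_n -> R[i]) (u : 'I_n -> A) :
  star (\sum_j c j *: u j) = \sum_j conjc (c j) *: star (u j).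
Proof.
elim/big_rec2: _ => [|j y1 y2 _ <-]; first exact: star0.
by rewrite starD starZ.
Qed.

Lemma star1 : star 1 = 1.
Proof.
rewrite -[RHS](star_involutive sA) -[star 1 in RHS]mul1r (star_antimul sA).
by rewrite (star_involutive sA) mul1r.
Qed.

End StarAxioms.

(** * The norm of L^2(B, tau) and operator norms of left multiplications *)

Section L2.
Variables (R : realType) (X : fusion_bialgebra R).
Hypothesis sX : star_axioms (@fb_star R X).

Lemma L2normZ (r : R) (v : fb_B X) :
  0 <= r -> L2norm (r%:C *: v) = r * L2norm v.
Proof.
move=> r0; rewrite /L2norm (starZ sX) conjc_real -scalerAl -scalerAr scalerA.
rewrite linearZ /=; case: (fb_tau X _) => a b /=.
have -> : (r * r - 0 * 0) * a - (r * 0 + 0 * r) * b = r ^+ 2 * a by ring.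
by rewrite sqrtrM ?sqr_ge0 // sqrtr_sqr ger0_norm.
Qed.

(** The upper bound [K] is attained at the eigenvector [w] scaled to norm 1. *)
Lemma lmul_norm_eigen (b w : fb_B X) (K : R) :
    0 <= K -> (forall v, L2norm (b * v) <= K * L2norm v) ->
    0 < L2norm w -> b * w = K%:C *: w ->
  lmul_norm b = K.
Proof.
move=> K0 bK w0 bw; apply/le_anti/andP; split.
  apply: ge_sup => [|_ [a /= a1 <-]].
    (* Bounding the supremum needs a nonempty unit ball; the zero vector, written [0%:C *: w], lies
       in it. *)
    exists (L2norm (b * (0%:C *: w))), (0%:C *: w) => //=.
    by rewrite L2normZ // mul0r.
  by apply: le_trans (bK a) _; rewrite -[leRHS]mulr1 ler_wpM2l.
apply: ub_le_sup.
  exists K => _ [a /= a1 <-].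
  by apply: le_trans (bK a) _; rewrite -[leRHS]mulr1 ler_wpM2l.
exists ((L2norm w)^-1%:C *: w) => /=.
  by rewrite L2normZ ?mulVf ?gt_eqF // invr_ge0 ltW.
rewrite -scalerAr bw scalerA -rmorphM L2normZ.
  by rewrite mulrAC mulVf ?mul1r ?gt_eqF.
by rewrite mulr_ge0 // invr_ge0 ltW.
Qed.

Variables (n : nat) (x : n.+1.-tuple (fb_B X)).
Hypotheses (xX : rnn_basis (@fb_star R X) x)
  (tauX : forall j, fb_tau X (tnth x j) = (j == ord0)%:R).

Lemma tau_coord v : fb_tau X v = coord x ord0 v.
Proof.
have bx := rnn_basis_linear xX.
rewrite {1}(coord_tnth_basis v bx) linear_sum /= (bigD1 ord0) //= linearZ /=.
rewrite tauX eqxx mulr1 big1 ?addr0 // => i /negbTE i0.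
by rewrite linearZ /= tauX i0 mulr0.
Qed.

(** The basis is orthonormal: [fb_tau] reads off the coefficient of x_1, and in x_j^* x_i this is 1
    for i = j and 0 otherwise. *)
Lemma L2norm_sum (c : 'I_n.+1 -> R[i]) :
  L2norm (\sum_j c j *: tnth x j) =
  Num.sqrt (\sum_j (complex.Re (c j) ^+ 2 + complex.Im (c j) ^+ 2)).
Proof.
have [dual [dualK starx N1]] := rnn_basis_dual xX.
congr Num.sqrt; rewrite (star_sum sX) mulr_suml linear_sum /=.
rewrite raddf_sum; apply: eq_bigr => j _.
rewrite mulr_sumr linear_sum /= (bigD1 j) //= big1 ?addr0.
  rewrite starx -scalerAl -scalerAr scalerA linearZ /= tau_coord.
  rewrite [coord _ _ _]N1 eqxx mulr1.
  by case: (c j) => a b /=; ring.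
move=> i ij; rewrite starx -scalerAl -scalerAr scalerA linearZ /= tau_coord.
rewrite [coord _ _ _]N1 (inj_eq (can_inj dualK)) eq_sym (negbTE ij).
by rewrite mulr0.
Qed.

End L2.

(** * Fusion rules and norms in dimension three *)

Local Notation i0 := (@ord0 2).
Local Notation i1 := (@Ordinal 3 1 isT).
Local Notation i2 := (@Ordinal 3 2 isT).

Lemma ord3_ind (P : 'I_3 -> Prop) : P i0 -> P i1 -> P i2 -> forall i, P i.
Proof.
by move=> P0 P1 P2 [[|[|[|//]]] i3]; [move: P0|move: P1|move: P2];
   congr P; apply/val_inj.
Qed.

Lemma sum_ord3 (V : nmodType) (F : 'I_3 -> V) :
  \sum_i F i = F i0 + F i1 + F i2.
Proof.
rewrite !big_ord_recl big_ord0 addr0 addrA.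
by congr (F _ + F _ + F _); apply/val_inj.
Qed.

(** The left side is the squared norm of x_2 (u x_1 + v x_2 + w x_3) for real u, v, w. *)
Lemma fusion_matrix_bound (R : realType) (d u v w : R) : 1 <= d ->
  let a := (d ^+ 2 - 1) / (2 * d) in let b := (d ^+ 2 + 1) / (2 * d) in
  w ^+ 2 + (u + a * v + a * w) ^+ 2 + (b * v + a * w) ^+ 2
    <= d ^+ 2 * (u ^+ 2 + v ^+ 2 + w ^+ 2).
Proof.
move=> d1 /=; have d0 : 0 < d by apply: lt_le_trans d1.
set a := _ / _; set b := (_ + 1) / _; rewrite -subr_ge0.
(* The three squares vanish together exactly on the multiples of (1, d, d), the eigenvector, where
   equality has to hold. *)
have -> : d ^+ 2 * (u ^+ 2 + v ^+ 2 + w ^+ 2) -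
    (w ^+ 2 + (u + a * v + a * w) ^+ 2 + (b * v + a * w) ^+ 2) =
    (d ^+ 2 - 1) / (2 * d ^+ 2) *
      ((d * (v - w)) ^+ 2 + (v - d * u) ^+ 2 + (w - d * u) ^+ 2).
  by rewrite /a /b; field; rewrite gt_eqF.
apply: mulr_ge0; last by rewrite !addr_ge0 ?sqr_ge0.
by apply: divr_ge0; nra.
Qed.

Lemma tnth3E T (a b c : T) :
  (tnth [tuple a; b; c] i0 = a) * (tnth [tuple a; b; c] i1 = b) *
  (tnth [tuple a; b; c] i2 = c).
Proof. by []. Qed.

Section ThreeDim.
Variables (R : realType) (X : fusion_bialgebra R) (x1 x2 x3 : fb_B X).
Let x := [tuple x1; x2; x3].
Hypotheses (sX : star_axioms (@fb_star R X))
  (xX : rnn_basis (@fb_star R X) x) (x23 : fb_star x2 = x3).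

Lemma basis_fst_eq1 : x1 = 1. Proof. exact: rnn_basis_one xX. Qed.

Lemma star_third : fb_star x3 = x2.
Proof. by rewrite -x23 (star_involutive sX). Qed.

Lemma coord_basis3 :
  (forall i, coord x i x1 = (i == i0)%:R) *
  (forall i, coord x i x2 = (i == i1)%:R) *
  (forall i, coord x i x3 = (i == i2)%:R).
Proof.
have cx i j := coord_tnth i j (rnn_basis_linear xX).
by split=> [|i]; [split=> i; [rewrite -(cx i i0)|rewrite -(cx i i1)]|
  rewrite -(cx i i2)].
Qed.

Lemma fusion_parameter :
  exists2 d : R, 1 <= d & fusion_rules x1 x2 x3 d /\ x3 * x2 = x2 * x3.
Proof.
have bx := rnn_basis_linear xX; have cx := coord_basis3.
have [dual [dualK starx N1]] := rnn_basis_dual xX.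
(* Basis elements are distinct, so x_2^* = x_3 determines [dual] on the last two indices. *)
have x_inj j k : tnth x j = tnth x k -> j = k.
  move/(congr1 (coord x j)); rewrite !coord_tnth // eqxx.
  by case: eqP => // _ /eqP; rewrite oner_eq0.
have dual1 : dual i1 = i2 by apply: x_inj; rewrite -starx.
have dual2 : dual i2 = i1 by rewrite -dual1 dualK.
have x1E := basis_fst_eq1.
(* Nonnegativity makes the coefficients of x_2 and x_3 real; that of x_1 is given by duality. *)
have decomp j k : exists b c : R, [/\ 0 <= b, 0 <= c &
    tnth x j * tnth x k = (j == dual k)%:R *: x1 + b%:C *: x2 + c%:C *: x3].
  have [b b0 bE] := complex_ge0P (rnn_basis_ge0 xX j k i1).
  have [c c0 cE] := complex_ge0P (rnn_basis_ge0 xX j k i2).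
  exists b, c; split=> //; rewrite [LHS](coord_tnth_basis _ bx) sum_ord3.
  by rewrite -bE -cE -N1.
have [a [b [a0 b0 e22]]] := decomp i1 i1.
have [c [c' [c0 _ e23]]] := decomp i1 i2.
have [e [e' [_ _ e32]]] := decomp i2 i1.
move: e22 e23 e32; rewrite dual1 dual2 !eqxx /= scale0r add0r scale1r.
rewrite -[tnth x i1]/x2 -[tnth x i2]/x3 => e22 e23 e32.
have starR (r : R) (u : fb_B X) : fb_star (r%:C *: u) = r%:C *: fb_star u.
  by rewrite (starZ sX) conjc_real.
have e33 : x3 * x3 = b%:C *: x2 + a%:C *: x3.
  rewrite -x23 -(star_antimul sX) e22 (starD sX) !starR x23 star_third.
  exact: addrC.
(* x_2 x_3 is self-adjoint and the star exchanges x_2 and x_3, so its coefficients at x_2 and x_3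
   agree; likewise for x_3 x_2 below. *)
have cc' : c' = c.
  have := congr1 (@fb_star R X) e23.
  rewrite (star_antimul sX) star_third x23 e23.
  rewrite !(starD sX) !starR x23 star_third.
  rewrite {2}x1E (star1 sX) -x1E.
  move=> /(congr1 (fun u => complex.Re (coord x i2 u))) /=.
  rewrite !linearD !linearZ /= !cx /=; lra.
have ee' : e' = e.
  have := congr1 (@fb_star R X) e32.
  rewrite (star_antimul sX) star_third x23 e32.
  rewrite !(starD sX) !starR x23 star_third.
  rewrite {2}x1E (star1 sX) -x1E.
  move=> /(congr1 (fun u => complex.Re (coord x i2 u))) /=.
  rewrite !linearD !linearZ /= !cx /=; lra.
subst c' e'.
(* In x_2 (x_2 x_3) = (x_2 x_2) x_3 the coefficient of x_1 gives c = a, and that of x_2 gives b^2 =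
   1 + a^2. *)
have := mulrA x2 x2 x3; rewrite e22 e23 x1E !mulrDr !mulrDl mulr1.
rewrite -!scalerAr -!scalerAl e22 e23 e33 -x1E => assoc.
have ca : c = a.
  have /(congr1 (fun u => complex.Re (coord x i0 u))) /= := assoc.
  rewrite !(linearD, linearZ) /= !cx /=; lra.
have bb : b ^+ 2 = 1 + a ^+ 2.
  have /(congr1 (fun u => complex.Re (coord x i1 u))) /= := assoc.
  rewrite !(linearD, linearZ) /= !cx /= ca; nra.
(* The coefficient of x_1 in x_3 (x_2 x_2) = (x_3 x_2) x_2 gives e = a, whence commutativity. *)
have ea : e = a.
  have := mulrA x3 x2 x2; rewrite e22 e32 x1E !mulrDr !mulrDl mul1r.
  rewrite -!scalerAr -!scalerAl e22 e32 e33.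
  move=> /(congr1 (fun u => complex.Re (coord x i0 u))) /=.
  rewrite !(linearD, linearZ) /= !cx /=; lra.
have b1 : 1 <= b by nra.
have ab0 : a + b != 0 by rewrite gt_eqF // ltr_wpDl // (lt_le_trans ltr01).
(* With d = a + b, the relation (b - a)(b + a) = 1 gives b - a = 1/d, so a = (d - 1/d)/2 and b = (d
   + 1/d)/2. *)
exists (a + b); first lra.
have -> : fusion_rules x1 x2 x3 (a + b) <->
    [/\ x2 * x2 = a%:C *: x2 + b%:C *: x3,
        x2 * x3 = x1 + a%:C *: (x2 + x3) &
        x3 * x3 = b%:C *: x2 + a%:C *: x3].
  rewrite /fusion_rules.
  have -> : ((a + b) ^+ 2 - 1) / (2 * (a + b)) = a.
    by apply: (mulIf ab0); field: bb.
  have -> : ((a + b) ^+ 2 + 1) / (2 * (a + b)) = b.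
    by apply: (mulIf ab0); field: bb.
  by [].
by rewrite e32 e23 ca ea scalerDr !addrA.
Qed.

Lemma L2norm_comb3 (u v w : R[i]) :
    (forall j, fb_tau X (tnth x j) = (j == ord0)%:R) ->
  L2norm (u *: x1 + v *: x2 + w *: x3) =
  Num.sqrt ((complex.Re u ^+ 2 + complex.Re v ^+ 2 + complex.Re w ^+ 2)
          + (complex.Im u ^+ 2 + complex.Im v ^+ 2 + complex.Im w ^+ 2)).
Proof.
move=> tauX; have := L2norm_sum sX xX tauX (tnth [tuple u; v; w]).
by rewrite !sum_ord3 => ->; congr Num.sqrt; rewrite !tnth3E; ring.
Qed.

Lemma lmul_norm_basis (d : R) :
    (forall j, fb_tau X (tnth x j) = (j == ord0)%:R) ->
    1 <= d -> fusion_rules x1 x2 x3 d -> x3 * x2 = x2 * x3 ->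
  [/\ lmul_norm x1 = 1, lmul_norm x2 = d & lmul_norm x3 = d].
Proof.
move=> tauX d1 [e22 e23 e33] e32; rewrite e23 in e32.
have d0 : 0 <= d by apply: le_trans d1.
have L2E := L2norm_comb3 _ _ _ tauX.
have decomp v : exists a b c, v = a *: x1 + b *: x2 + c *: x3.
  by rewrite (coord_tnth_basis v (rnn_basis_linear xX)) sum_ord3; do 3!eexists.
have x1E := basis_fst_eq1.
set a := (d ^+ 2 - 1) / _ in e22 e23 e33 e32.
set b := (d ^+ 2 + 1) / _ in e22 e33.
have mul2 u v w : x2 * (u *: x1 + v *: x2 + w *: x3) =
    w *: x1 + (u + a%:C * v + a%:C * w) *: x2 + (b%:C * v + a%:C * w) *: x3.
  rewrite !mulrDr -!scalerAr {1}x1E mulr1 e22 e23.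
  apply: (coord_inj_basis (rnn_basis_linear xX)) => i.
  by rewrite !(linearD, linearZ) /= !coord_basis3; ring.
have mul3 u v w : x3 * (u *: x1 + v *: x2 + w *: x3) =
    v *: x1 + (b%:C * w + a%:C * v) *: x2 + (u + a%:C * w + a%:C * v) *: x3.
  rewrite !mulrDr -!scalerAr {1}x1E mulr1 e32 e33.
  apply: (coord_inj_basis (rnn_basis_linear xX)) => i.
  by rewrite !(linearD, linearZ) /= !coord_basis3; ring.
have ReM (r : R) z : complex.Re (r%:C * z) = r * complex.Re z.
  by case: z => ? ? /=; ring.
have ImM (r : R) z : complex.Im (r%:C * z) = r * complex.Im z.
  by case: z => ? ? /=; ring.
(* The matrix of x_2 is real, so the real and imaginary parts of the coordinates are bounded
   separately. *)
have bound u v w : L2norm (w *: x1 + (u + a%:C * v + a%:C * w) *: x2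
      + (b%:C * v + a%:C * w) *: x3)
      <= d * L2norm (u *: x1 + v *: x2 + w *: x3).
  rewrite !L2E -(ger0_norm d0) -sqrtr_sqr -sqrtrM ?sqr_ge0 //.
  rewrite ler_wsqrtr // mulrDr !raddfD /= !ReM !ImM.
  by apply: lerD; apply: fusion_matrix_bound.
(* Exchanging the coordinates at x_2 and x_3 is an isometry that carries left multiplication by x_2
   to that by x_3, so one bound serves both. *)
have swap u v w : L2norm (u *: x1 + v *: x2 + w *: x3) =
    L2norm (u *: x1 + w *: x2 + v *: x3).
  by rewrite !L2E; congr Num.sqrt; ring.
(* The coordinates at x_2 and x_3 of the eigenvalue equation for 1 + d x_2 + d x_3. *)
have dE2 : 1 + a%:C * d%:C + a%:C * d%:C = d%:C * d%:C.
  rewrite -[1]/(1%:C) -!rmorphM -!rmorphD.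
  congr (_%:C); rewrite /a; field; rewrite gt_eqF //; lra.
have dE1 : b%:C * d%:C + a%:C * d%:C = d%:C * d%:C.
  rewrite -!rmorphM -!rmorphD.
  congr (_%:C); rewrite /a /b; field; rewrite gt_eqF //; lra.
have eigen : 0 < L2norm (1 *: x1 + d%:C *: x2 + d%:C *: x3).
  by rewrite L2E sqrtr_gt0 /=; nra.
split.
- apply: (lmul_norm_eigen sX ler01 _ eigen) => [v|]; rewrite {1}x1E ?mul1r //.
  by rewrite scale1r [RHS]scale1r.
- apply: (lmul_norm_eigen sX d0 _ eigen) => [v|].
    by have [{}u [{}v [w ->]]] := decomp v; rewrite mul2.
  by rewrite mul2 dE1 dE2 !scalerDr !scalerA mulr1.
- apply: (lmul_norm_eigen sX d0 _ eigen) => [v|].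
    have [{}u [{}v [w ->]]] := decomp v.
    by rewrite mul3 (swap u v w) [leLHS]swap.
  by rewrite mul3 dE1 dE2 !scalerDr !scalerA mulr1.
Qed.

Lemma fusion_classification :
    (forall j, fb_tau X (tnth x j) = (j == ord0)%:R) ->
  exists2 d : R, 1 <= d &
    [/\ fusion_rules x1 x2 x3 d, x3 * x2 = x2 * x3,
        [/\ lmul_norm x1 = 1, lmul_norm x2 = d & lmul_norm x3 = d] &
        FPdim x = 1 + 2 * d ^+ 2].
Proof.
move=> tauX; have [d d1 [rules comm]] := fusion_parameter.
have norms := lmul_norm_basis tauX d1 rules comm.
exists d => //; split=> //; rewrite /FPdim sum_ord3.
by case: norms => -> -> ->; ring.
Qed.

End ThreeDim.

(** * Isomorphisms built from bases *)

Section BasisMap.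
Variables (K : fieldType) (n : nat).

Definition basis_map (U V : vectType K) (e : n.-tuple U) (e' : n.-tuple V)
  (u : U) : V := \sum_i coord e i u *: tnth e' i.

Lemma basis_map_linear (U V : vectType K) (e : n.-tuple U) (e' : n.-tuple V) :
  linear (basis_map e e').
Proof.
move=> a u v; rewrite /basis_map scaler_sumr -big_split.
by apply: eq_bigr => i _; rewrite linearP scalerDl scalerA.
Qed.

HB.instance Definition _ (U V : vectType K)
    (e : n.-tuple U) (e' : n.-tuple V) :=
  GRing.isLinear.Build K U V _ (basis_map e e') (basis_map_linear e e').

Lemma basis_map_tnth (U V : vectType K) (e : n.-tuple U) (e' : n.-tuple V) i :
  basis_of fullv e -> basis_map e e' (tnth e i) = tnth e' i.
Proof.
move=> be; rewrite /basis_map (bigD1 i) //= coord_tnth // eqxx scale1r.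
by rewrite big1 ?addr0 // => j /negbTE ji; rewrite coord_tnth // ji scale0r.
Qed.

Lemma basis_mapK (U V : vectType K) (e : n.-tuple U) (e' : n.-tuple V) :
  basis_of fullv e -> basis_of fullv e' ->
  cancel (basis_map e e') (basis_map e' e).
Proof.
move=> be be' u; rewrite {2}(coord_tnth_basis u be) {1}/basis_map.
by apply: eq_bigr => i _; rewrite coord_sum_tnth.
Qed.

Lemma basis_map_lrmorphism (A B : falgType K)
    (e : n.-tuple A) (e' : n.-tuple B) :
    basis_of fullv e -> basis_of fullv e' ->
    (forall i j,
       basis_map e e' (tnth e i * tnth e j) = tnth e' i * tnth e' j) ->
  exists2 f : {lrmorphism A -> B},
    bijective f & forall i, f (tnth e i) = tnth e' i.
Proof.
move=> be be' multe; pose phi : {linear A -> B} := basis_map e e'.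
have phiK : cancel (basis_map e' e) phi by apply: basis_mapK.
have phiM : {morph phi : u v / u * v}.
  move=> u v; rewrite [in LHS](coord_tnth_basis u be).
  rewrite [in LHS](coord_tnth_basis v be).
  rewrite mulr_suml linear_sum [RHS]mulr_suml; apply: eq_bigr => i _.
  rewrite mulr_sumr linear_sum [RHS]mulr_sumr; apply: eq_bigr => j _.
  by rewrite -!scalerAl -!scalerAr !linearZ /= multe !scalerA mulrC.
(* A surjective multiplicative map preserves the unit: if phi(u) = 1, then phi(1) = phi(1) phi(u) =
   phi(u) = 1. *)
have phi1 : phi 1 = 1.
  by rewrite -[LHS]mulr1 -[X in _ * X](phiK 1) -phiM mul1r phiK.
pose phi_monoid :=
  GRing.isMonoidMorphism.Build A B (basis_map e e') (phi1, phiM).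
pose f : {lrmorphism A -> B} := HB.pack (basis_map e e') phi_monoid.
exists f; last by move=> i; apply: basis_map_tnth.
by exists (basis_map e' e) => //; apply: basis_mapK.
Qed.

End BasisMap.

(* The elements [d(x_j) y_j] are the minimal idempotents of A, so their sum is
   the unit, and [d] takes the value [\sum_j d(x_j)^2] on it. *)
Lemma FPdim_fb_d1 (R : realType) (X : fusion_bialgebra R) n
    (x : n.+1.-tuple (fb_B X)) :
    canonical_fusion_bialgebra x -> (forall j, lmul_norm (tnth x j) != 0) ->
  fb_d X 1 = (FPdim x)%:C.
Proof.
move=> [_ _ _ _ [y [by_ _ dy yy _]]] d_neq0.
have <- : \sum_j fb_d X (tnth y j) *: tnth y j = 1.
  rewrite -[LHS]mulr1 [X in _ * X](coord_tnth_basis 1 by_) mulr_sumr.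
  rewrite [RHS](coord_tnth_basis 1 by_); apply: eq_bigr => k _.
  rewrite -scalerAr mulr_suml (bigD1 k) //= big1 ?addr0.
    rewrite -scalerAl yy eqxx; congr (_ *: _).
    rewrite scalerA mulfV ?scale1r // dy.
    by rewrite eq_complex /= eqxx andbT.
  by move=> j /negbTE jk; rewrite -scalerAl yy jk scaler0.
rewrite linear_sum /= /FPdim rmorph_sum; apply: eq_bigr => j _ /=.
by rewrite linearZ /= dy -rmorphM.
Qed.

Lemma canonical_star_morph (R : realType) (A B : falgType R[i])
    (sA : A -> A) (sB : B -> B) n (e : n.-tuple A) (g : {linear A -> B}) :
    star_axioms sA -> star_axioms sB -> basis_of fullv e ->
    (forall i, g (sA (tnth e i)) = sB (g (tnth e i))) ->
  forall u, g (sA u) = sB (g u).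
Proof.
move=> axA axB be ge u.
rewrite (coord_tnth_basis u be) (star_sum axA) !linear_sum.
under [in RHS]eq_bigr do rewrite linearZ.
by rewrite (star_sum axB); apply: eq_bigr => i _; rewrite linearZ /= ge.
Qed.

(** The product on A depends only on the numbers d(x_j), so equal norms already make the map between
    the A-sides multiplicative; products are compared only in B. *)
Lemma fb_isomorphic_basis (R : realType) (X Y : fusion_bialgebra R) n
    (x : n.+1.-tuple (fb_B X)) (x' : n.+1.-tuple (fb_B Y))
    (dual : 'I_n.+1 -> 'I_n.+1) :
    canonical_fusion_bialgebra x -> canonical_fusion_bialgebra x' ->
    (forall j, lmul_norm (tnth x j) = lmul_norm (tnth x' j)) ->
    (forall j, fb_star (tnth x j) = tnth x (dual j)) ->
    (forall j, fb_star (tnth x' j) = tnth x' (dual j)) ->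
    (forall j k,
       basis_map x x' (tnth x j * tnth x k) = tnth x' j * tnth x' k) ->
  fb_isomorphic X Y.
Proof.
move=> [starX /rnn_basis_linear bx taux sharpX [y [by_ Fy dy yy sharpy]]].
move=> [starY /rnn_basis_linear bx' taux' sharpY].
move=> [y' [by_' Fy' dy' yy' sharpy']].
move=> eq_d dualx dualx' multx.
have multy j k : basis_map y y' (tnth y j * tnth y k) = tnth y' j * tnth y' k.
  rewrite yy yy'; case: eqP => [_|_]; last exact: linear0.
  by rewrite linearZ /= basis_map_tnth // dy dy' eq_d.
have [f f_bij fy] := basis_map_lrmorphism by_ by_' multy.
have [g g_bij gx] := basis_map_lrmorphism bx bx' multx.
exists f, g; split=> //; [| | |split].
- by apply: canonical_star_morph by_ _ => // i; rewrite /= fy sharpy sharpy' fy.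
- by apply: canonical_star_morph bx _ => // i; rewrite /= gx dualx gx dualx'.
- move=> a; rewrite (coord_tnth_basis a by_) !linear_sum; apply: eq_bigr => i _.
  by rewrite !linearZ /= Fy fy Fy' gx.
- move=> a; rewrite (coord_tnth_basis a by_) !linear_sum; apply: eq_bigr => i _.
  by rewrite !linearZ /= fy dy dy' eq_d.
- move=> a; rewrite (coord_tnth_basis a bx) !linear_sum; apply: eq_bigr => i _.
  by rewrite !linearZ /= gx taux taux'.
Qed.

(** An isomorphism preserves the unit of A and [fb_d], whose value there is mu. Conversely, mu = 1 +
    2 d^2 with d >= 1 determines d, hence all products. *)
Lemma fb_isomorphic3 (R : realType) (X Y : fusion_bialgebra R)
    (x1 x2 x3 : fb_B X) (y1 y2 y3 : fb_B Y) :
    canonical_fusion_bialgebra [tuple x1; x2; x3] -> fb_star x2 = x3 ->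
    canonical_fusion_bialgebra [tuple y1; y2; y3] -> fb_star y2 = y3 ->
  fb_isomorphic X Y <-> FPdim [tuple x1; x2; x3] = FPdim [tuple y1; y2; y3].
Proof.
move=> canX x23 canY y23.
have [sX xX taux _ _] := canX; have [sY yY tauy _ _] := canY.
have [d d1 [[r22 r23 r33] r32 [nx1 nx2 nx3] FPx]] :=
  fusion_classification sX xX x23 taux.
have [e e1 [rulesy s32 [ny1 ny2 ny3] FPy]] :=
  fusion_classification sY yY y23 tauy.
have d0 : d != 0 by rewrite gt_eqF // (lt_le_trans ltr01).
have e0 : e != 0 by rewrite gt_eqF // (lt_le_trans ltr01).
split=> [[f [g [_ _ _ _ [df _]]]]|].
  have: (FPdim [tuple x1; x2; x3])%:C = (FPdim [tuple y1; y2; y3])%:C.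
    rewrite -!FPdim_fb_d1 // -?df ?rmorph1 //.
      by elim/ord3_ind; rewrite !tnth3E ?ny1 ?oner_eq0 ?ny2 ?ny3.
    by elim/ord3_ind; rewrite !tnth3E ?nx1 ?oner_eq0 ?nx2 ?nx3.
  by case.
rewrite FPx FPy => eq_de; have {}eq_de : e = d by nra.
rewrite {}eq_de in rulesy ny2 ny3; have [s22 s23 s33] := rulesy.
pose dual (j : 'I_3) : 'I_3 :=
  if j == i0 then i0 else if j == i1 then i2 else i1.
apply: (fb_isomorphic_basis (dual := dual) canX canY).
- by elim/ord3_ind; rewrite !tnth3E ?nx1 ?nx2 ?nx3 ?ny1 ?ny2 ?ny3.
- elim/ord3_ind; rewrite !tnth3E ?(basis_fst_eq1 xX) ?(star1 sX) //.
  exact: star_third.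
- elim/ord3_ind; rewrite !tnth3E ?(basis_fst_eq1 yY) ?(star1 sY) //.
  exact: star_third.
- have bx := rnn_basis_linear xX.
  have phi1 := basis_map_tnth [tuple y1; y2; y3] i0 bx.
  have phi2 := basis_map_tnth [tuple y1; y2; y3] i1 bx.
  have phi3 := basis_map_tnth [tuple y1; y2; y3] i2 bx.
  rewrite !tnth3E in phi1 phi2 phi3.
  have x1E := basis_fst_eq1 xX; have y1E := basis_fst_eq1 yY.
  elim/ord3_ind; elim/ord3_ind; rewrite !tnth3E.
  all: rewrite ?{1}x1E ?{1}y1E ?mul1r ?mulr1 -?x1E -?y1E ?r32 ?s32.
  all: rewrite ?r22 ?r23 ?r33 ?s22 ?s23 ?s33 ?(linearD, linearZ) /=.
  all: rewrite ?phi1 ?phi2 ?phi3 ?scalerDr //.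
Qed.

(** Dual functionals force [e] to be free and the dimension makes it a basis; its coordinates are
    then explicit. *)
Lemma dual_basis (K : fieldType) (V : vectType K) n (e : n.-tuple V)
    (c : 'I_n -> {scalar V}) :
    dim V = n -> (forall i j, c i (tnth e j) = (i == j)%:R) ->
  basis_of fullv e /\ forall i v, coord e i v = c i v.
Proof.
move=> dimV ce.
have c_sum k i : c i (\sum_j k j *: tnth e j) = k i.
  rewrite linear_sum (bigD1 i) //= linearZ /= ce eqxx mulr1.
  rewrite big1 ?addr0 // => j ji.
  by rewrite linearZ /= ce eq_sym (negbTE ji) mulr0.
have be : basis_of fullv e.
  rewrite basisEfree subvf size_tuple dimvf dimV leqnn !andbT.
  apply/freeP => k k0 i; rewrite -(c_sum k i).
  under eq_bigr do rewrite (tnth_nth 0).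
  by rewrite k0 linear0.
by split=> // i v; rewrite [in RHS](coord_tnth_basis v be) c_sum.
Qed.

(** * The model on C^3 with pointwise operations *)

Section Model.
Variable R : realType.

Definition cube : Type := ((R[i])^o * (R[i])^o * (R[i])^o)%type.

HB.instance Definition _ := GRing.UnitAlgebra.on cube.
HB.instance Definition _ := Vector.on cube.

Lemma cubeE (u v : cube) :
  u.1.1 = v.1.1 -> u.1.2 = v.1.2 -> u.2 = v.2 -> u = v.
Proof. by case: u v => [[? ?] ?] [[? ?] ?] /= -> -> ->. Qed.

Definition cube_conj (u : cube) : cube := (conjc u.1.1, conjc u.1.2, conjc u.2).

Lemma cube_star_axioms : star_axioms cube_conj.
Proof.
split=> [a u v|u|u v]; apply: cubeE => /=; rewrite ?conjcK //.
- by rewrite rmorphD rmorphM.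
- by rewrite rmorphD rmorphM.
- by rewrite rmorphD rmorphM.
- by rewrite rmorphM mulrC.
- by rewrite rmorphM mulrC.
- by rewrite rmorphM mulrC.
Qed.

(** A bilinear pairing without conjugation; fixing [p] yields every linear functional on C^3. *)
Definition cube_form (p u : cube) : R[i] :=
  p.1.1 * u.1.1 + p.1.2 * u.1.2 + p.2 * u.2.

Lemma cube_form_scalar p : scalar (cube_form p).
Proof.
move=> a u v; rewrite /cube_form /= -[a *: u.1.1]/(a * u.1.1).
by rewrite -[a *: u.1.2]/(a * u.1.2) -[a *: u.2]/(a * u.2); ring.
Qed.

HB.instance Definition _ p :=
  GRing.isLinear.Build R[i] cube R[i] _ (cube_form p) (cube_form_scalar p).

Lemma cube_basis (e c : 3.-tuple cube) :
    (forall i j, cube_form (tnth c i) (tnth e j) = (i == j)%:R) ->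
  basis_of fullv e /\ forall i v, coord e i v = cube_form (tnth c i) v.
Proof.
by move=> ce; apply: (dual_basis (c := fun i => cube_form (tnth c i))).
Qed.

Lemma cube_scaleE (a b : R[i]) : a *: (b : R[i]^o) = a * b.
Proof. by []. Qed.

(* The values of [x_2] at the two nontrivial characters are [z] and its
   conjugate; [z] is a root of [Z^2 + Z / d + (1 + d^-2) / 2]. *)
Lemma model_root (d : R) : d != 0 -> exists z : R[i],
  conjc z = - d%:C^-1 - z /\ z ^+ 2 = - z / d%:C - (1 + d%:C ^- 2) / 2.
Proof.
(* The sum -1/d forces the real part -1/(2d); [q] is then chosen so that |z|^2 = (1 + d^-2)/2. *)
move=> d0; pose q : R := Num.sqrt (2^-1 + (2 * d) ^- 2).
pose z : R[i] := (- (2 * d)^-1) +i* q; exists z.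
have zb : conjc z = - d%:C^-1 - z.
  rewrite -fmorphV; apply/eqP; rewrite eq_complex /=; apply/andP.
  split; apply/eqP.
    by field.
  by ring.
split=> //; have -> : (1 + d%:C ^- 2) / 2 = ((1 + d ^- 2) / 2)%:C.
  by rewrite rmorphM rmorphD !fmorphV rmorphXn rmorph1 rmorph_nat.
have q2 : q ^+ 2 = 2^-1 + (2 * d) ^- 2.
  by rewrite sqr_sqrtr // addr_ge0 ?invr_ge0 ?sqr_ge0.
rewrite -fmorphV; apply/eqP; rewrite eq_complex /=; apply/andP.
split; apply/eqP; first rewrite -[q * q]/(q ^+ 2) q2; field; exact: d0.
Qed.

Variables (d : R) (z : R[i]).
Let D : R[i] := d%:C.
Hypotheses (d1 : 1 <= d) (zb : conjc z = - D^-1 - z)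
  (zz : z ^+ 2 = - z / D - (1 + D ^- 2) / 2).

Lemma model_dneq0 : D != 0.
Proof. by rewrite eq_complex /= eqxx andbT gt_eqF // (lt_le_trans ltr01). Qed.

Lemma model_total_neq0 : 1 + 2 * D ^+ 2 != 0.
Proof.
have -> : 1 + 2 * D ^+ 2 = (1 + 2 * d ^+ 2)%:C.
  by rewrite rmorphD rmorphM rmorphXn /= rmorph1 rmorph_nat.
by rewrite eq_complex /= eqxx andbT gt_eqF //; nra.
Qed.

(** By [zb] this is the conjugate of [z], written without [conjc] so that [field] applies. *)
Let w : R[i] := - D^-1 - z.

(** [z] and [w] are the two roots of one quadratic, so products of the values of x_2 and x_3 at the
    nontrivial characters reduce to degree at most one. *)
Lemma model_quadratic : [/\ z * z = - z / D - (1 + D ^- 2) / 2,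
  w * w = - w / D - (1 + D ^- 2) / 2, z * w = (1 + D ^- 2) / 2 &
  w * z = (1 + D ^- 2) / 2].
Proof.
have D0 := model_dneq0.
have zw : z * w = (1 + D ^- 2) / 2 by rewrite mulrBr -expr2 zz; field.
split=> //; last by rewrite mulrC.
have -> : w * w = D ^- 2 + 2 * z / D + z ^+ 2 by rewrite /w; field.
by rewrite zz /w; field.
Qed.

Let x1 : cube := 1.
Let x2 : cube := (D, z, w).
Let x3 : cube := (D, w, z).
Let y1 : cube := (1, 0, 0).
Let y2 : cube := (0, D^-1, 0).
Let y3 : cube := (0, 0, D^-1).
Let x := [tuple x1; x2; x3].
Let y := [tuple y1; y2; y3].
(* The trace has weights [1 / (1 + 2 d^2)] and, twice, [d^2 / (1 + 2 d^2)], so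
   that [cube_form (wt u) v] is the trace of [u * v]. *)
Let wt (u : cube) : cube :=
  (u.1.1 / (1 + 2 * D ^+ 2), u.1.2 * D ^+ 2 / (1 + 2 * D ^+ 2),
   u.2 * D ^+ 2 / (1 + 2 * D ^+ 2)).

(** The weights 1, d^2, d^2 of [fb_d] give y_1, y_2, y_3 the values 1, d, d. *)
Definition model : fusion_bialgebra R :=
  FusionBialgebra cube_conj cube_conj (basis_map y x)
    (cube_form (1, D ^+ 2, D ^+ 2)) (cube_form (wt 1)).

Lemma model_fusion_rules : @fusion_rules R model x1 x2 x3 d.
Proof.
have D0 := model_dneq0; have [zz2 ww2 zw wz] := model_quadratic.
rewrite /fusion_rules.
have -> : ((d ^+ 2 - 1) / (2 * d))%:C = (D ^+ 2 - 1) / (2 * D).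
  by rewrite rmorphM rmorphB fmorphV rmorphXn rmorphM rmorph1 rmorph_nat.
have -> : ((d ^+ 2 + 1) / (2 * d))%:C = (D ^+ 2 + 1) / (2 * D).
  by rewrite rmorphM rmorphD fmorphV rmorphXn rmorphM rmorph1 rmorph_nat.
split; apply: cubeE; rewrite /= !cube_scaleE ?(zz2, ww2, zw, wz).
all: by rewrite /w; field.
Qed.

Lemma model_conj :
  [/\ cube_conj x1 = x1, cube_conj x2 = x3 & cube_conj x3 = x2].
Proof.
have wz : conjc w = z by rewrite /w -zb conjcK.
have DD : conjc D = D by apply: conjc_real.
by split; apply: cubeE; first [exact: conjc1|exact: DD|exact: zb|exact: wz].
Qed.

Lemma model_inner u v : cube_form (wt u) v =
  (u.1.1 * v.1.1 + D ^+ 2 * (u.1.2 * v.1.2 + u.2 * v.2)) / (1 + 2 * D ^+ 2).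
Proof. by rewrite /cube_form /=; field; exact: model_total_neq0. Qed.

Lemma model_basis : basis_of fullv x /\
  forall i v, coord x i v = cube_form (wt (cube_conj (tnth x i))) v.
Proof.
have D0 := model_dneq0; have [zz2 ww2 zw wz] := model_quadratic.
have W0 := model_total_neq0.
(* By orthonormality the coordinate functionals should be v -> tau(x_i^* v); conjugation exchanges
   x_2 and x_3, hence the order of the weights. *)
have [|bx cx] := @cube_basis x [tuple wt x1; wt x3; wt x2].
{ elim/ord3_ind; elim/ord3_ind.
  all: rewrite !tnth3E model_inner /= ?(zz2, ww2, zw, wz).
  all: by rewrite /w; field; rewrite W0. }
split=> // i v; rewrite cx; congr cube_form.
by have [c1 c2 c3] := model_conj; elim/ord3_ind: i; rewrite !tnth3E ?c1 ?c2 ?c3.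
Qed.

Lemma model_comm : x3 * x2 = x2 * x3.
Proof. by apply: cubeE; rewrite /= mulrC. Qed.

Lemma model_rnn_basis : @rnn_basis R cube cube_conj 2 x.
Proof.
have [bx cx] := model_basis; have [c1 c2 c3] := model_conj.
have [r22 r23 r33] := model_fusion_rules.
have coordx i j : coord x i (tnth x j) = (i == j)%:R by apply: coord_tnth.
have [e1 e2 e3] : [/\ forall i, coord x i x1 = (i == i0)%:R,
    forall i, coord x i x2 = (i == i1)%:R &
    forall i, coord x i x3 = (i == i2)%:R].
  by split=> i; rewrite -coordx tnth3E.
have r32 := model_comm.
have d0 : 0 <= d by apply: le_trans d1.
(* The inequality d >= 1 makes this coefficient nonnegative. *)
have a0 : 0 <= ((d ^+ 2 - 1) / (2 * d))%:C.
  by rewrite lecR divr_ge0 ?mulr_ge0 // subr_ge0 exprn_ege1.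
have b0 : 0 <= ((d ^+ 2 + 1) / (2 * d))%:C.
  by rewrite lecR divr_ge0 ?mulr_ge0 // addr_ge0 ?sqr_ge0.
pose dual (j : 'I_3) : 'I_3 :=
  if j == i0 then i0 else if j == i1 then i2 else i1.
split=> //.
{ elim/ord3_ind; elim/ord3_ind; elim/ord3_ind; rewrite /fusion_coef !tnth3E.
  all: rewrite ?mul1r ?mulr1 ?r32 ?(r22, r23, r33).
  all: rewrite ?(linearD, linearZ) /= ?(e1, e2, e3).
  all: by rewrite /= ?(mulr1, mulr0, addr0, add0r) ?lexx ?ler01. }
exists dual; split; first by elim/ord3_ind.
  by elim/ord3_ind; rewrite !tnth3E ?c1 ?c2 ?c3.
elim/ord3_ind; elim/ord3_ind; rewrite /fusion_coef !tnth3E.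
all: rewrite ?mul1r ?mulr1 ?r32 ?(r22, r23, r33).
all: rewrite ?(linearD, linearZ) /= ?(e1, e2, e3).
all: by rewrite /= ?(mulr1, mulr0, addr0, add0r).
Qed.

Lemma model_tau j : fb_tau model (tnth x j) = (j == ord0)%:R.
Proof.
have [bx cx] := model_basis; rewrite eq_sym -(coord_tnth _ _ bx) cx.
by rewrite tnth3E; case: model_conj => ->.
Qed.

Lemma model_star : @fb_star R model x2 = x3.
Proof. by case: model_conj. Qed.

(** The model obeys the fusion rules, so [lmul_norm_basis] gives its operator norms 1, d, d, which
    [fb_d] matches on [y]. *)
Lemma model_canonical : @canonical_fusion_bialgebra R model 2 x.
Proof.
have [n1 n2 n3] := @lmul_norm_basis R model x1 x2 x3 cube_star_axioms
  model_rnn_basis d model_tau d1 model_fusion_rules model_comm.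
have D0 := model_dneq0.
(* The listed vectors are dual to [y] under the pairing. *)
have [|by_ _] := @cube_basis y
  [tuple (1, 0, 0) : cube; (0, D, 0) : cube; (0, 0, D) : cube].
{ elim/ord3_ind; elim/ord3_ind; rewrite !tnth3E /cube_form /=.
  all: by field. }
have dy j : fb_d model (tnth y j) = (lmul_norm (tnth x j : fb_B model))%:C.
  elim/ord3_ind: j; rewrite !tnth3E ?n1 ?n2 ?n3 /= /cube_form /=.
  - by ring.
  - by field.
  - by field.
split; [exact: cube_star_axioms|exact: model_rnn_basis|exact: model_tau
  |exact: cube_star_axioms|exists y; split=> //].
- by move=> j; apply: basis_map_tnth.
{ move=> j k; rewrite dy; elim/ord3_ind: j; elim/ord3_ind: k.
  all: rewrite !tnth3E /= ?n1 ?n2 ?n3; apply: cubeE; rewrite /= ?cube_scaleE.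
  all: rewrite ?mulr0 ?mul0r //.
  all: by rewrite -/D ?fmorphV; field. }
have DD : conjc D^-1 = D^-1 by rewrite -fmorphV conjc_real.
by elim/ord3_ind; rewrite !tnth3E; apply: cubeE;
  first [exact: conjc0|exact: conjc1|exact: DD].
Qed.

End Model.

Theorem proposition2p29 (R : realType) :
  (* every such canonical fusion bialgebra has mu >= 3 and the stated rules *)
  (forall (X : fusion_bialgebra R) (x1 x2 x3 : fb_B X),
     canonical_fusion_bialgebra [tuple x1; x2; x3] -> fb_star x2 = x3 ->
     let mu := FPdim [tuple x1; x2; x3] in
     let d2 := lmul_norm x2 in
     let d3 := lmul_norm x3 in
     [/\ 3 <= mu, d2 = Num.sqrt ((mu - 1) / 2), d3 = Num.sqrt ((mu - 1) / 2)
       & fusion_rules x1 x2 x3 d2])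
  /\
  (* every real mu >= 3 is realized *)
  (forall mu : R, 3 <= mu ->
     let d2 := Num.sqrt ((mu - 1) / 2) in
     exists (X : fusion_bialgebra R) (x1 x2 x3 : fb_B X),
     [/\ canonical_fusion_bialgebra [tuple x1; x2; x3], fb_star x2 = x3,
         FPdim [tuple x1; x2; x3] = mu,
         lmul_norm x2 = d2 /\ lmul_norm x3 = d2
       & fusion_rules x1 x2 x3 d2])
  /\
  (* mu is a complete isomorphism invariant *)
  (forall (X Y : fusion_bialgebra R)
          (x1 x2 x3 : fb_B X) (y1 y2 y3 : fb_B Y),
     canonical_fusion_bialgebra [tuple x1; x2; x3] -> fb_star x2 = x3 ->
     canonical_fusion_bialgebra [tuple y1; y2; y3] -> fb_star y2 = y3 ->
     (fb_isomorphic X Y <->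
      FPdim [tuple x1; x2; x3] = FPdim [tuple y1; y2; y3])).
Proof.
split; [|split].
- move=> X x1 x2 x3 [sX xX taux _ _] x23 mu d2 d3.
  have [d dge1 [rules _ [_ n2 n3] FP]] := fusion_classification sX xX x23 taux.
  rewrite /d2 /d3 /mu n2 n3 FP.
  have -> : (1 + 2 * d ^+ 2 - 1) / 2 = d ^+ 2 by field.
  rewrite sqrtr_sqr ger0_norm ?(le_trans ler01) //; split=> //; nra.
- move=> mu mu3 d2.
  have mu0 : 0 <= (mu - 1) / 2 by lra.
  have d2E : d2 ^+ 2 = (mu - 1) / 2 by rewrite sqr_sqrtr.
  (* The bound mu >= 3 says exactly that d_2 >= 1. *)
  have dge1 : 1 <= d2 by rewrite -sqrtr1 ler_sqrt //; lra.
  have dneq0 : d2 != 0 by rewrite gt_eqF // (lt_le_trans ltr01).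
  have [z [zb zz]] := model_root dneq0.
  have can := model_canonical dge1 zb zz.
  have x23 := model_star zb.
  have [sX xX taux _ _] := can.
  have rules := model_fusion_rules dge1 zz.
  have comm := model_comm d2 z.
  have [n1 n2 n3] := lmul_norm_basis sX xX taux dge1 rules comm.
  exists (model d2 z); do 3 eexists.
  split; [exact: can|exact: x23| |by split; [exact: n2|exact: n3]|exact: rules].
  by rewrite /FPdim sum_ord3 !tnth3E n1 n2 n3 d2E; field.
- exact: fb_isomorphic3.
Qed.
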